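(* Let $C$ be a linear code in $\mathbb{Z}_4^n$ which contains the all-ones vector $\mathbf{1}$ and whose set of Lee weights is $$\{0,n,2n,a_1,2n-a_1,\ldots,a_t,2n-a_t\}.$$ Then $\phi(C)$ is an $s$-distance set of size $|C|/4$ in $\mathbb{C}^n$ for some $s\le\binom{t+2}{2}$.
   Context: A linear code in $\mathbb{Z}_4^n$ is a $\mathbb{Z}_4$-submodule. Writing $\mathbb{Z}_4=\{-1,0,1,2\}$, the Lee weight of $x\in\mathbb{Z}_4$ is $|x|$, and the Lee weight of a vector in $\mathbb{Z}_4^n$ is the sum of the Lee weights of its coordinates. For $c=(c_1,\dots,c_n)\in\mathbb{Z}_4^n$, $\phi(c):=(i^{c_1},\dots,i^{c_n})\in\mathbb{C}^n$, where $i=\sqrt{-1}$. Vectors are normalized to unit length and considered projectively: two vectors spanning the same one-dimensional subspace are identified, and the size of $\phi(C)$ is the number of distinct lines spanned by the vectors $\phi(c)$, $c\in C$. A set $X$ of unit vectors spanning pairwise distinct lines is an $s$-distance set if $\{|x^*y|^2:x,y\in X,x\ne y\}$ has exactly $s$ elements. *)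

(* Defs.v *)
From HB Require Import structures.
From mathcomp Require Import all_boot all_order all_algebra finmap.
From mathcomp Require Import spectral reals complex.

Set Implicit Arguments.
Unset Strict Implicit.
Unset Printing Implicit Defensive.

Import Order.TTheory GRing.Theory Num.Theory.
Local Open Scope sesquilinear_scope.
Local Open Scope fset_scope.
Local Open Scope ring_scope.

Definition linear_code n (C : {set 'rV['Z_4]_n}) : Prop :=
  GRing.submod_closed (mem C).

(* Elements of 'Z_4 are ordinals 0, 1, 2, 3; this is the representative in
   {-1, 0, 1, 2}. *)
Definition z4_rep (x : 'Z_4) : int :=
  if (x <= 2)%N then (x : nat)%:Z else (x : nat)%:Z - 4.

Definition lee_weight n (c : 'rV['Z_4]_n) : nat :=
  (\sum_(j < n) `|z4_rep (c 0%R j)|)%N.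

Definition lee_weights n (C : {set 'rV['Z_4]_n}) : seq nat :=
  [seq lee_weight c | c in C].

Section ComplexVectors.

Variables (R : realType) (n : nat).

(* The exponent is an int, so ^ is the integer power. *)
Definition phi (c : 'rV['Z_4]_n) : 'cV[R[i]]_n :=
  \col_j ('i%C : R[i]) ^ z4_rep (c 0 j).

(* The code phi(C) viewed projectively. Scaling phi c to unit length does not
   change the line it spans. *)
Definition phi_lines (C : {set 'rV['Z_4]_n}) : {fset {vspace 'cV[R[i]]_n}} :=
  [fset <[phi c]>%VS | c in C].

Definition cdot (x y : 'cV[R[i]]_n) : R[i] := (x ^t* *m y) 0 0.

Definition unit_line_system (X : {fset 'cV[R[i]]_n}) : Prop :=
  (forall x, x \in X -> cdot x x = 1) /\
  {in X &, injective (fun x => <[x]>%VS)}.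

Definition distances (X : {fset 'cV[R[i]]_n}) : {fset R[i]} :=
  [fset `|cdot x y| ^+ 2 | x in X, y in X `\ x].

Definition s_distance_set (s : nat) (X : {fset 'cV[R[i]]_n}) : Prop :=
  unit_line_system X /\ #|` distances X| = s.

(* X consists of exactly one unit vector on each line of L. *)
Definition unit_representatives (L : {fset {vspace 'cV[R[i]]_n}})
    (X : {fset 'cV[R[i]]_n}) : Prop :=
  unit_line_system X /\ [fset <[x]>%VS | x in X] = L.

(* A set of lines is an s-distance set when its unit representatives are. The
   moduli do not depend on the representatives; representatives exist as soon
   as all members of L are one-dimensional, and existence is required so that
   the definition is never vacuous. *)
Definition s_distance_lines (s : nat) (L : {fset {vspace 'cV[R[i]]_n}}) : Prop :=
  (exists X, unit_representatives L X) /\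
  forall X, unit_representatives L X -> s_distance_set s X.

End ComplexVectors.

(* Main.v *)
(* The real part of i^x is 1 - |x| and its imaginary part is the real part of
   i^(x - 1). Summing over the coordinates, for codewords c, d and e = d - c,
     |phi(c)^* phi(d)|^2 = (n - wt(e))^2 + (n - wt(e - 1))^2.
   Both e and e - 1 lie in C. Neither has weight 0 or 2n unless e is constant,
   that is, unless phi(c) and phi(d) span the same line; so both squares are
   among 0 and the (n - a_i)^2. These are t + 1 values, and they have at most
   binom(t + 2, 2) sums of two. *)

Require Import Defs.
From mathcomp Require Import all_boot all_order all_algebra finmap.
From mathcomp Require Import reals complex.
From mathcomp Require Import ring.

Set Implicit Arguments.
Unset Strict Implicit.
Unset Printing Implicit Defensive.

Import Order.TTheory GRing.Theory Num.Theory.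
Local Open Scope ring_scope.

(** * Powers of i with exponents in Z/4 *)

Section Powers.
Variable F : numClosedFieldType.
Implicit Types x y : 'Z_4.

Definition i_pow x : F := 'i ^ z4_rep x.

(** The representatives -1 and 3 give the same power, since i^3 = i^-1. *)
Lemma i_powE x : i_pow x = 'i ^+ x.
Proof.
have i3 : 'i ^+ 3 = 'i^-1 :> F.
  by rewrite invCi exprSr sqrCi mulN1r.
by case: x => -[|[|[|[|]]]].
Qed.

Lemma i_pow0 : i_pow 0 = 1. Proof. by []. Qed.

Lemma i_powD x y : i_pow (x + y) = i_pow x * i_pow y.
Proof.
rewrite !i_powE -exprD -[RHS](@expr_mod _ 4) //.
by rewrite (exprM _ 2 2) sqrCi sqrrN expr1n.
Qed.

(** Both sides are inverse to [i_pow x], which has modulus 1. *)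
Lemma conj_i_pow x : (i_pow x)^* = i_pow (- x).
Proof.
have norm_i_pow : i_pow x * (i_pow x)^* = 1.
  by rewrite -normCK i_powE normrX normCi !expr1n.
have := i_powD x (- x); rewrite subrr i_pow0 -norm_i_pow => /mulfI -> //.
by rewrite -normr_gt0 i_powE normrX normCi expr1n ltr01.
Qed.

Lemma i_pow_eq1 x : i_pow x = 1 -> x = 0.
Proof.
have N11 : -1 != 1 :> F by rewrite eq_sym -subr_eq0 opprK -mulr2n pnatr_eq0.
have i1 : 'i != 1 :> F.
  by apply/eqP=> i1; move: N11; rewrite -sqrCi i1 expr1n eqxx.
rewrite i_powE; case: x => -[|[|[|[|//]]]] lt4 /= /eqP.
- by move=> _; apply: val_inj.
- by rewrite expr1 (negPf i1).
- by rewrite sqrCi (negPf N11).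
- move=> /eqP /(congr1 (fun z => z * 'i)); rewrite -exprSr mul1r => E.
  by case/eqP: i1; rewrite -E (exprM _ 2 2) sqrCi sqrrN expr1n.
Qed.

Lemma i_pow_inj : injective i_pow.
Proof.
move=> x y xy; apply/eqP; rewrite -subr_eq0; apply/eqP/i_pow_eq1.
by rewrite i_powD xy -i_powD subrr.
Qed.

Lemma i_pow_rect x :
  i_pow x = (1 - `|z4_rep x|%N%:R) + 'i * (1 - `|z4_rep (x - 1)%R|%N%:R).
Proof.
rewrite i_powE; case: x => -[|[|[|[|//]]]] lt4.
(* For x = 0, 1, 2, 3 the Lee weight of x - 1 computes to 1, 0, 1, 2. *)
- by rewrite -[ absz (z4_rep (_ - 1)%R)]/1%N /=; ring.
- by rewrite -[ absz (z4_rep (_ - 1)%R)]/0%N /=; ring.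
- by rewrite -[ absz (z4_rep (_ - 1)%R)]/1%N /= sqrCi; ring.
- rewrite -[ absz (z4_rep (_ - 1)%R)]/2%N -[ absz (z4_rep _)]/1%N /= exprSr sqrCi; ring.
Qed.
End Powers.

(** * Extreme Lee weights *)

Lemma lee_weight_le n (c : 'rV['Z_4]_n) : (lee_weight c <= 2 * n)%N.
Proof.
rewrite /lee_weight -[n in leqRHS]card_ord -sum1_card big_distrr leq_sum // => j _.
by case: (c 0 j) => -[|[|[|[|]]]].
Qed.

Lemma lee_weight_eq0 n (c : 'rV['Z_4]_n) : lee_weight c = 0%N -> c = 0.
Proof.
move=> /eqP; rewrite sum_nat_eq0 => /forallP c0.
apply/rowP=> j; rewrite mxE; move: (c0 j) => /=.
by case: (c 0 j) => -[|[|[|[|]]]] // ? _; apply: val_inj.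
Qed.

Lemma lee_weight_eq2n n (c : 'rV['Z_4]_n) :
  lee_weight c = (2 * n)%N -> c = const_mx 2.
Proof.
move=> /eqP c2n; apply/rowP=> j; rewrite mxE.
have le2 (k : 'I_n) : (`|z4_rep (c 0%R k)| <= 2)%N.
  by case: (c 0 k) => -[|[|[|[|]]]].
(* The deficits from the maximal weight 2 add up to 0, so each vanishes; [le2] makes the natural
   subtraction exact. *)
have : (\sum_(k < n) (2 - `|z4_rep (c 0%R k)|) == 0)%N.
  rewrite -(eqn_add2r (lee_weight c)) -big_split /=.
  rewrite (eq_bigr (fun=> 2%N)) => [|k _]; last exact: subnK.
  by rewrite sum_nat_const card_ord mulnC (eqP c2n) add0n.
rewrite sum_nat_eq0 => /forallP /(_ j) /=.
by case: (c 0 j) => -[|[|[|[|]]]] // ? _; apply: val_inj.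
Qed.

(** * Inner products of the vectors [phi c] *)

Section Phi.
Variables (R : realType) (n : nat).
Implicit Types c d : 'rV['Z_4]_n.

Lemma phiE c j : phi R c j 0 = i_pow R[i] (c 0 j).
Proof. by rewrite mxE complexiE. Qed.

Lemma cdot_phi c d :
  cdot (phi R c) (phi R d) =
    (n%:R - (lee_weight (d - c))%:R) +
    'i * (n%:R - (lee_weight (d - c - const_mx 1))%:R).
Proof.
rewrite /cdot mxE.
under eq_bigr => j _ do
  rewrite !mxE complexiE -!/(i_pow _ _) conj_i_pow -i_powD addrC i_pow_rect.
rewrite big_split /= -mulr_sumr !sumrB sumr_const card_ord !natr_sum.
congr (_ - _ + 'i * (_ - _)).
  by apply: eq_bigr => j _; rewrite !mxE.
by apply: eq_bigr => j _; rewrite !mxE.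
Qed.

Lemma cdot_phi_norm c d :
  `|cdot (phi R c) (phi R d)| ^+ 2 =
    (n%:R - (lee_weight (d - c))%:R) ^+ 2 +
    (n%:R - (lee_weight (d - c - const_mx 1))%:R) ^+ 2.
Proof. by rewrite cdot_phi normC2_rect // rpredB ?realn. Qed.

Lemma cdotZ (k l : R[i]) (x y : 'cV[R[i]]_n) :
  cdot (k *: x) (l *: y) = k^* * l * cdot x y.
Proof.
rewrite /cdot !mxE mulr_sumr; apply: eq_bigr => j _.
by rewrite !mxE rmorphM; ring.
Qed.

Lemma cdot_phi_self c : cdot (phi R c) (phi R c) = n%:R.
Proof.
rewrite /cdot mxE (eq_bigr (fun=> 1)) => [|j _].
  by rewrite sumr_const card_ord.
by rewrite !mxE complexiE -!/(i_pow _ _) conj_i_pow -i_powD addNr.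
Qed.

End Phi.

Lemma line_scale (K : fieldType) (V : vectType K) (k : K) (x : V) :
  k != 0 -> <[k *: x]>%VS = <[x]>%VS.
Proof.
move=> k0; apply/eqP; rewrite eqEsubv -!memvE memvZ ?memv_line //=.
by rewrite -[X in X \in _](scalerK k0) memvZ ?memv_line.
Qed.

(** * Independence of the distances from the unit representatives *)

Section Lines.
Variables (R : realType) (n : nat).
Implicit Types (x y : 'cV[R[i]]_n) (X Y : {fset 'cV[R[i]]_n}).

Lemma unit_vectors_on_line x y :
  cdot x x = 1 -> cdot y y = 1 -> <[x]>%VS = <[y]>%VS ->
  exists2 k : R[i], `|k| = 1 & x = k *: y.
Proof.
move=> xx yy xy; have : x \in <[y]>%VS by rewrite -xy memv_line.
case/vlineP=> k xE; exists k => //; apply/eqP.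
rewrite -(pexpr_eq1 (n := 2)) // normCK mulrC.
by rewrite -xx xE cdotZ yy mulr1.
Qed.

Lemma distancesP X (r : R[i]) :
  reflect (exists x y, [/\ x \in X, y \in X, x != y & r = `|cdot x y| ^+ 2])
    (r \in distances X).
Proof.
apply: (iffP (imfset2P _ _ _ _ _)) => [[x xX [y]]|[x [y [xX yX xy ->]]]].
  by rewrite !inE => /andP[yx yX] ->; exists x, y; rewrite eq_sym.
by exists x => //; exists y => //; rewrite !inE eq_sym xy.
Qed.

(** Each vector of [X] is a unimodular multiple of the vector of [Y] on the same line, and such
    factors do not affect the modulus of an inner product. *)
Lemma distances_subset L X Y :
  unit_representatives L X -> unit_representatives L Y ->
  {subset distances X <= distances Y}.
Proof.
move=> [[X1 Xinj] XL] [[Y1 Yinj] YL] r /distancesP[x [y [xX yX xy ->]]].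
have rep z : z \in X ->
    exists z' (k : R[i]), [/\ z' \in Y, `|k| = 1 & z = k *: z'].
  move=> zX; have : <[z]>%VS \in L by rewrite -XL; apply/imfsetP; exists z.
  rewrite -YL => /imfsetP[z' /= z'Y zz'].
  by have [k] := unit_vectors_on_line (X1 _ zX) (Y1 _ z'Y) zz'; exists z', k.
have [x' [k [x'Y k1 xE]]] := rep _ xX; have [y' [l [y'Y l1 yE]]] := rep _ yX.
apply/distancesP; exists x', y'; split=> //; last first.
  by rewrite xE yE cdotZ !normrM norm_conjC k1 l1 !mul1r.
(* If the two representatives in [Y] coincided, [x] and [y] would span the same line. *)
apply: contra_neq xy => x'y'; apply: Xinj => //; rewrite xE yE x'y'.
have nz (m : R[i]) : `|m| = 1 -> m != 0.
  by move=> m1; rewrite -normr_gt0 m1.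
by rewrite !line_scale ?nz.
Qed.

Lemma eq_distances L X Y :
  unit_representatives L X -> unit_representatives L Y ->
  distances X = distances Y.
Proof.
by move=> XL YL; apply/fsetP=> r; apply/idP/idP; apply: distances_subset; eauto.
Qed.

End Lines.

(** Addition commutes, so every sum comes from a weakly increasing pair of indices, and
    [card_sorted_tuples] counts these pairs. *)
Lemma card_pair_sums (V : zmodType) t (v : 'I_t.+1 -> V) (D : {fset V}) :
  (forall r, r \in D -> exists i j, r = v i + v j) -> (#|` D| <= 'C(t + 2, 2))%N.
Proof.
move=> DE; pose f (u : 2.-tuple 'I_t.+1) := v (tnth u 0) + v (tnth u 1).
pose A := [set u : 2.-tuple 'I_t.+1 | sorted leq (map val u)].
rewrite addnC -card_sorted_tuples -/A -(size_image f).
apply: uniq_leq_size => [|r /DE[i [j ->]]]; first exact: fset_uniq.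
wlog le_ij : i j / (i <= j)%N.
  by case/orP: (leq_total i j) => le H; [|rewrite addrC]; apply: H.
by apply/imageP; exists [tuple i; j] => //; rewrite inE /= le_ij.
Qed.

(** * The lines of the code and their number *)

Section Code.
Variables (R : realType) (n : nat) (C : {set 'rV['Z_4]_n}).
Hypotheses (linC : linear_code C) (oneC : const_mx 1%R \in C).
Implicit Types c d : 'rV['Z_4]_n.

Lemma phi_const c k : phi R (c + const_mx k) = i_pow R[i] k *: phi R c.
Proof.
apply/colP=> j; rewrite [RHS]mxE !phiE.
by rewrite !mxE i_powD mulrC.
Qed.

Lemma code_sub c d : c \in C -> d \in C -> d - c \in C.
Proof.
by move=> cC dC; have := linC.2 (-1) _ _ cC dC; rewrite scaleN1r addrC.
Qed.

Lemma code_const c k : c \in C -> c + const_mx k \in C.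
Proof.
by move=> cC; have := linC.2 k _ _ oneC cC; rewrite scalemx_const mulr1 addrC.
Qed.

(* A transversal of the cosets of the multiples of the all-ones word. *)
Definition code_slice (j : 'I_n) := [set c in C | c 0%R j == 0%R].

(** Every codeword is uniquely a word of the slice plus a constant word, the constant being its
    [j]-th coordinate. *)
Lemma card_code_slice j : (4 * #|code_slice j| = #|C|)%N.
Proof.
have f_inj : {in setX [set: 'Z_4] (code_slice j) &,
    injective (fun p : 'Z_4 * 'rV['Z_4]_n => p.2 + const_mx p.1)}.
  move=> [k c] [l d]; rewrite !inE /= => /andP[_ /eqP c0] /andP[_ /eqP d0] E.
  have kl : k = l.
    by move/rowP/(_ j): (E); rewrite !mxE c0 d0 !add0r.
  by move: E; rewrite kl => /addIr ->.
have card_Z4 : #|[set: 'Z_4]| = 4%N by rewrite cardsT card_ord.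
rewrite -[X in (X * _)%N]card_Z4 -cardsX -(card_in_imset f_inj); congr #|pred_of_set _|.
apply/setP=> c; apply/imsetP/idP => [[[k d]]|cC].
  by rewrite !inE /= => /andP[dC _] ->; apply: code_const.
exists (c 0 j, c - const_mx (c 0 j)); last by rewrite subrK.
rewrite !inE /= !mxE subrr eqxx andbT.
by have := code_const (- c 0 j) cC; rewrite raddfN.
Qed.

(** The proportionality factor is read off at coordinate [j], where both vectors have entry 1. *)
Lemma phi_line_inj j :
  {in code_slice j &, injective (fun c => <[phi R c]>%VS)}.
Proof.
move=> c d; rewrite !inE => /andP[_ /eqP c0] /andP[_ /eqP d0] cd.
have : phi R c \in <[phi R d]>%VS by rewrite -cd memv_line.
case/vlineP=> k E; apply/rowP=> l.
have kE m : i_pow R[i] (c 0 m) = k * i_pow R[i] (d 0 m).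
  by rewrite -!phiE E [LHS]mxE.
have := kE j; rewrite c0 d0 i_pow0 mulr1 => k1.
by apply: (@i_pow_inj R[i]); rewrite kE -k1 mul1r.
Qed.

Lemma phi_linesE j :
  phi_lines R C = [fset <[phi R c]>%VS | c in code_slice j]%fset.
Proof.
apply/fsetP=> L; apply/imfsetP/imfsetP => -[c /= cC ->]; last first.
  by exists c => //; move: cC; rewrite inE => /andP[].
(* This translate lies in the slice, and its image is a multiple of [phi R c] by a power of i. *)
exists (c + const_mx (- c 0 j)).
  by rewrite inE code_const // !mxE subrr eqxx.
by rewrite phi_const line_scale // i_powE expf_neq0 // neq0Ci.
Qed.

Lemma card_phi_lines (j : 'I_n) : (4 * #|` phi_lines R C| = #|C|)%N.
Proof.
rewrite -(card_code_slice j) (phi_linesE j).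
by rewrite card_in_imfset; [rewrite /= -cardE|exact: phi_line_inj].
Qed.

(** * Unit representatives of the lines *)

Hypothesis n_gt0 : (0 < n)%N.

Definition unit_phi c : 'cV[R[i]]_n := (sqrtC n%:R)^-1 *: phi R c.

Lemma cdot_unit_phi c d :
  cdot (unit_phi c) (unit_phi d) = n%:R^-1 * cdot (phi R c) (phi R d).
Proof.
rewrite cdotZ; congr (_ * _).
rewrite conj_Creal ?rpredV ?ger0_real ?sqrtC_ge0 ?ler0n //.
by rewrite -invfM -expr2 sqrtCK.
Qed.

Lemma line_unit_phi c : <[unit_phi c]>%VS = <[phi R c]>%VS.
Proof.
by rewrite line_scale // invr_eq0 sqrtC_eq0 pnatr_eq0 -lt0n.
Qed.

Lemma unit_phi_representatives j :
  unit_representatives (phi_lines R C)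
    [fset unit_phi c | c in code_slice j]%fset.
Proof.
split; first split.
- move=> _ /imfsetP[c /= _ ->].
  by rewrite cdot_unit_phi cdot_phi_self mulVf // pnatr_eq0 -lt0n.
- move=> _ _ /imfsetP[c /= cS ->] /imfsetP[d /= dS ->].
  by rewrite !line_unit_phi => /(phi_line_inj cS dS) ->.
- rewrite (phi_linesE j); apply/fsetP=> L; apply/imfsetP/imfsetP => /=.
    by case=> _ /imfsetP[c /= cS ->] ->; exists c; rewrite ?line_unit_phi.
  case=> c cS ->; exists (unit_phi c); last by rewrite line_unit_phi.
  by apply/imfsetP; exists c.
Qed.

(** * Bounding the number of distances *)

Variables (t : nat) (a : t.-tuple nat).
Hypothesis weightsC : lee_weights C =i
  [:: 0; n; 2 * n]%N ++ flatten [seq [:: b; 2 * n - b]%N | b <- a].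

(** The weights b and 2n - b differ from n by opposite amounts, so each pair yields one square.
    Index 0 stands for the weight n, and the entries of [a] are shifted by one. *)
Lemma weight_defect_sqr (F : comPzRingType) c :
    c \in C -> lee_weight c != 0%N -> lee_weight c != (2 * n)%N ->
  exists i : 'I_t.+1,
    (n%:R - (lee_weight c)%:R) ^+ 2 =
    (n%:R - (nth 0%N (n :: a) i)%:R) ^+ 2 :> F.
Proof.
move=> cC c0 c2n.
have : lee_weight c \in lee_weights C by apply/imageP; exists c.
rewrite weightsC mem_cat !inE (negPf c0) (negPf c2n) orbF /=.
case/orP=> [/eqP ->|/flatten_mapP[b ba]]; first by exists ord0.
have ib : (index b a < t)%N by rewrite -[t in ltnRHS](size_tuple a) index_mem.
rewrite !inE => cb; exists (Ordinal (ib : (index b a).+1 < t.+1)%N).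
rewrite /= nth_index //; case/orP: cb => /eqP -> //.
(* The natural subtraction 2n - b is not truncated, because b is itself a Lee weight of the code. *)
have leb : (b <= 2 * n)%N.
  have : b \in lee_weights C.
    rewrite weightsC mem_cat; apply/orP; right; apply/flatten_mapP.
    by exists b; rewrite ?inE ?eqxx.
  by case/imageP=> d _ ->; apply: lee_weight_le.
by rewrite natrB // natrM; ring.
Qed.

Lemma card_distances j :
  (#|` distances [fset unit_phi c | c in code_slice j]%fset| <= 'C(t + 2, 2))%N.
Proof.
pose v (i : 'I_t.+1) : R[i] :=
  (n%:R^-1) ^+ 2 * (n%:R - (nth 0%N (n :: a) i)%:R) ^+ 2.
apply: (@card_pair_sums _ _ v) => r /distancesP[x [y []]].
case/imfsetP=> c /= + -> /imfsetP[d /= + ->].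
rewrite !inE => /andP[cC /eqP c0] /andP[dC /eqP d0] cd ->.
have {}cd : c != d by apply: contra_neq cd => ->.
have eC k : d - c - const_mx k \in C.
  by rewrite -raddfN; apply/code_const/code_sub.
(* Both words vanish at [j], so a constant difference would be 0. *)
have e_const k : d - c != const_mx k.
  apply: contra_neq cd => E; apply/esym/subr0_eq; rewrite E.
  by move/rowP/(_ j): E; rewrite !mxE c0 d0 subrr => <-.
have weight0 k : lee_weight (d - c - const_mx k) != 0%N.
  by apply/eqP => /lee_weight_eq0/subr0_eq/eqP; rewrite (negPf (e_const k)).
(* Weight 2n forces the constant word 2, and then d - c would be constant too. *)
have weight2n k : lee_weight (d - c - const_mx k) != (2 * n)%N.
  apply/eqP => /lee_weight_eq2n/(canRL (subrK _))/eqP.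
  by rewrite -raddfD (negPf (e_const _)).
have sqrE k := weight_defect_sqr R[i] (eC k) (weight0 k) (weight2n k).
(* The shifts 0 and 1 give the squared real and imaginary parts. *)
have [[i iE] [l lE]] := (sqrE 0, sqrE 1); exists i, l.
have e0 : d - c - const_mx 0 = d - c by apply/rowP=> m; rewrite !mxE subr0.
rewrite e0 in iE.
rewrite cdot_unit_phi normrM exprMn cdot_phi_norm iE lE mulrDr.
by rewrite ger0_norm ?invr_ge0 ?ler0n.
Qed.

End Code.

Local Close Scope ring_scope.

Theorem theorem4p3p9 (R : realType) (n t : nat) (n_gt0 : (0 < n)%N)
    (C : {set 'rV['Z_4]_n}) (a : t.-tuple nat)
    (linC : linear_code C)
    (oneC : const_mx 1%R \in C)
    (weightsC : lee_weights C =i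
       [:: 0; n; 2 * n] ++ flatten [seq [:: b; 2 * n - b] | b <- a]) :
  exists s : nat,
    [/\ (s <= 'C(t + 2, 2))%N,
        (4 * #|` phi_lines R C| = #|C|)%N &
        s_distance_lines s (phi_lines R C)].
Proof.
pose j := Ordinal n_gt0.
have X0rep := unit_phi_representatives R linC oneC n_gt0 j.
(* Unification takes s to be the number of distances among the vectors [unit_phi c], for c in the
   slice at [j]. *)
eexists; split; last split; first exact: (card_distances R linC oneC weightsC j).
- exact: (card_phi_lines R linC oneC j).
- by eexists; exact: X0rep.
- by move=> X Xrep; split; [case: Xrep|rewrite (eq_distances Xrep X0rep)].
Qed.
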